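(* Let $R$ be a commutative ring with unit and let $f,g\colon X\to Y$ be continuous maps between path-connected topological spaces. Then $$\mathrm{l.c.p.}\,\mathcal{J}(f,g;R)\leq \mathrm{H}^{\bullet}\mathrm{D}(f,g;R).$$
   Context: $H^*(-;R)$ denotes singular cohomology. The cohomological distance $\mathrm{H}^{\bullet}\mathrm{D}(f,g;R)$ is the least integer $n\geq 0$ for which there exists an open cover $\{U_0,\dots,U_n\}$ of $X$ such that $(f_{|U_j})^*=(g_{|U_j})^*\colon H^m(Y;R)\to H^m(U_j;R)$ for all $m\geq 0$ and all $j=0,\dots,n$ (the $U_j$ need not be path-connected; the value is $\infty$ if no such $n$ exists). $\mathcal{J}(f,g;R)\subset H^*(X;R)$ denotes the image of $f^*-g^*\colon H^*(Y;R)\to H^*(X;R)$. $\mathrm{l.c.p.}\,\mathcal{J}(f,g;R)$ denotes the least integer $n\geq 0$ such that every cup product of $n+1$ elements of $\mathcal{J}(f,g;R)$ vanishes ($\infty$ if no such $n$ exists). *)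

(* Defs.v *)
From HB Require Import structures.
From mathcomp Require Import all_boot all_order all_algebra generic_quotient
  ring_quotient.
From mathcomp Require Import all_classical all_reals.
From mathcomp Require Import topology normedtype.
From mathcomp Require Import zify.

Set Implicit Arguments.
Unset Strict Implicit.
Unset Printing Implicit Defensive.

Import Order.TTheory GRing.Theory Num.Theory.
Import numFieldNormedType.Exports.

Local Open Scope classical_set_scope.
Local Open Scope ring_scope.

(* K is the field of real numbers (a realType is unique up to isomorphism).
   Singular cochains with coefficients in R are R-valued functions on singular
   simplices, i.e. elements of Hom(C_n(X), R) with C_n(X) free on them. *)

Section StandardSimplex.
Variable K : realType.

Definition std_simplex (n : nat) : set 'rV[K]_n.+1 :=
  [set t | (forall i, 0 <= t ord0 i) /\ \sum_i t ord0 i = 1].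
Arguments std_simplex n _ : clear implicits.

Definition vertex_map_fun (p n : nat) (phi : 'I_p.+1 -> 'I_n.+1)
  (t : 'rV[K]_p.+1) : 'rV[K]_n.+1 := \row_j \sum_(i | phi i == j) t ord0 i.

Lemma vertex_map_fun_simplex (p n : nat) (phi : 'I_p.+1 -> 'I_n.+1)
    (t : std_simplex p) :
  vertex_map_fun phi (set_val t) \in std_simplex n.
Proof.
have /set_mem[t0 t1] := valP t; apply/mem_set; split.
  by move=> j; rewrite mxE sumr_ge0 // => i _; exact: t0.
rewrite -t1 [RHS](partition_big phi xpredT)//=.
by apply: eq_bigr => j _; rewrite mxE.
Qed.

(* The affine map Delta^p -> Delta^n sending the i-th vertex to the
   (phi i)-th one. *)
Definition vertex_map (p n : nat) (phi : 'I_p.+1 -> 'I_n.+1)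
  (t : std_simplex p) : std_simplex n :=
  SigSub (vertex_map_fun_simplex phi t).

Lemma vertex_map_fun_continuous (p n : nat) (phi : 'I_p.+1 -> 'I_n.+1) :
  continuous (vertex_map_fun phi).
Proof.
move=> t A [P tP PA].
have tP' : forall k : 'I_1 * 'I_n.+1, nbhs t
    [set s : 'rV[K]_p.+1 | P k.1 k.2 (vertex_map_fun phi s k.1 k.2)].
  move=> [i j].
  have cij : continuous (fun s : 'rV[K]_p.+1 => vertex_map_fun phi s i j).
    rewrite (_ : (fun _ => _) =
        fun s : 'rV[K]_p.+1 => \sum_(k | phi k == j) s ord0 k); last first.
      by apply/funext => s; rewrite mxE.
    by apply: continuous_big => [|k _]; [exact: add_continuous|
                                         exact: coord_continuous].
  exact: (cij t _ (tP i j)).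
apply: (@filterS _ (nbhs t) _ _ _ _ (@filter_forall _ _ _ _ (nbhs_filter t) tP')) => s sP.
by apply: PA => i j; exact: (sP (i, j)).
Qed.

Lemma vertex_map_continuous (p n : nat) (phi : 'I_p.+1 -> 'I_n.+1) :
  continuous (vertex_map phi).
Proof.
apply: continuous_comp_initial => t.
apply: (@continuous_comp _ _ _ set_val (vertex_map_fun phi)).
  exact: initial_continuous.
exact: vertex_map_fun_continuous.
Qed.

HB.instance Definition _ (p n : nat) (phi : 'I_p.+1 -> 'I_n.+1) :=
  isContinuous.Build _ _ (vertex_map phi) (@vertex_map_continuous p n phi).

Lemma vertex_map_comp (p n m : nat) (phi : 'I_p.+1 -> 'I_n.+1)
    (psi : 'I_n.+1 -> 'I_m.+1) :
  vertex_map psi \o vertex_map phi = vertex_map (psi \o phi).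
Proof.
apply/funext => t; apply/val_inj/rowP => j /=; rewrite !mxE.
under eq_bigr do rewrite mxE.
rewrite (exchange_big_dep xpredT) //= [RHS]big_mkcond /=.
apply: eq_bigr => i _; case: ifPn => h.
  rewrite (big_pred1 (phi i)) // => k /=; rewrite [k == _]eq_sym.
  by case: (phi i =P k) => [<-|]; rewrite ?h ?andbF.
rewrite big_pred0 // => k /=.
by case: (phi i =P k) => [<-|]; rewrite ?(negPf h) ?andbF.
Qed.

End StandardSimplex.

Arguments std_simplex K n _ : clear implicits.

Section Cochains.
Variables (K : realType) (R : comPzRingType).

Definition singular_simplex (X : topologicalType) (n : nat) :=
  continuousType (std_simplex K n) X.

(* sigma restricted along the affine map given by phi on vertices *)
Definition subsimplex (X : topologicalType) (p n : nat)
    (sigma : singular_simplex X n) (phi : 'I_p.+1 -> 'I_n.+1) :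
  singular_simplex X p := sigma \o vertex_map phi.

Lemma subsimplex_comp (X : topologicalType) (p q n : nat)
    (sigma : singular_simplex X n) (phi : 'I_q.+1 -> 'I_n.+1)
    (psi : 'I_p.+1 -> 'I_q.+1) :
  subsimplex (subsimplex sigma phi) psi = subsimplex sigma (phi \o psi).
Proof.
by apply/continuousEP => t; rewrite /subsimplex/= -vertex_map_comp.
Qed.

Definition cochain (X : topologicalType) (n : nat) : Type :=
  singular_simplex X n -> R.

HB.instance Definition _ (X : topologicalType) (n : nat) :=
  GRing.Zmodule.copy (cochain X n) (singular_simplex X n -> R).

Definition coboundary (X : topologicalType) (n : nat) (c : cochain X n) :
  cochain X n.+1 :=
  fun sigma => \sum_(i < n.+2) (-1) ^+ i * c (subsimplex sigma (lift i)).

Lemma coboundary_is_zmod_morphism (X : topologicalType) (n : nat) :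
  zmod_morphism (@coboundary X n).
Proof.
move=> a b; apply/funext => s; rewrite /coboundary.
rewrite [RHS]/GRing.add /= [in RHS]/GRing.opp /= -sumrB.
by apply: eq_bigr => i _; rewrite -mulrBr.
Qed.

HB.instance Definition _ (X : topologicalType) (n : nat) :=
  GRing.isZmodMorphism.Build _ _ (@coboundary X n)
    (@coboundary_is_zmod_morphism X n).

Definition is_cocycle (X : topologicalType) (n : nat) :
  {pred cochain X n} := [pred c | `[< coboundary c = 0 >] ].

Lemma is_cocycle_zmod_closed (X : topologicalType) (n : nat) :
  zmod_closed (@is_cocycle X n).
Proof.
split=> [|a b]; rewrite !inE; first by rewrite raddf0.
by move=> a0 b0; rewrite coboundary_is_zmod_morphism a0 b0 subr0.
Qed.

HB.instance Definition _ (X : topologicalType) (n : nat) :=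
  GRing.isZmodClosed.Build _ (@is_cocycle X n) (@is_cocycle_zmod_closed X n).

Record cocycle (X : topologicalType) (n : nat) := Cocycle {
  cocycle_val :> cochain X n;
  cocycleP : cocycle_val \in @is_cocycle X n }.

HB.instance Definition _ (X : topologicalType) (n : nat) :=
  [isSub for @cocycle_val X n].
HB.instance Definition _ (X : topologicalType) (n : nat) :=
  [Choice of cocycle X n by <:].
HB.instance Definition _ (X : topologicalType) (n : nat) :=
  [SubChoice_isSubZmodule of cocycle X n by <:].

Definition coboundaries (X : topologicalType) (n : nat) : set (cochain X n) :=
  if n is m.+1 then range (@coboundary X m) else [set 0].

Definition is_coboundary (X : topologicalType) (n : nat) :
  {pred cocycle X n} := [pred z | `[< coboundaries (val z) >] ].

Lemma is_coboundary_zmod_closed (X : topologicalType) (n : nat) :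
  zmod_closed (@is_coboundary X n).
Proof.
split=> [|a b].
  rewrite inE; case: n => [|n] //=.
  by exists 0 => //; rewrite raddf0.
rewrite !inE; move: n a b; case=> [|n] a b /=.
  by move=> -> ->; rewrite subr0.
by move=> [u _ <-] [v _ <-]; exists (u - v) => //;
  rewrite coboundary_is_zmod_morphism.
Qed.

HB.instance Definition _ (X : topologicalType) (n : nat) :=
  GRing.isZmodClosed.Build _ (@is_coboundary X n)
    (@is_coboundary_zmod_closed X n).

Definition cohomology (X : topologicalType) (n : nat) : Type :=
  {ideal_quot @is_coboundary X n}.

HB.instance Definition _ (X : topologicalType) (n : nat) :=
  GRing.Zmodule.on (cohomology X n).

Definition coh_class (X : topologicalType) (n : nat) (z : cocycle X n) :
  cohomology X n := (\pi_{ideal_quot @is_coboundary X n} z)%qT.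

Definition coh_repr (X : topologicalType) (n : nat) (x : cohomology X n) :
  cocycle X n := repr (x : {ideal_quot @is_coboundary X n}).

Lemma coh_reprK (X : topologicalType) (n : nat) (x : cohomology X n) :
  coh_class (coh_repr x) = x.
Proof. exact: reprK. Qed.

Lemma coh_classP (X : topologicalType) (n : nat) (z w : cocycle X n) :
  coh_class z = coh_class w <-> coboundaries (val (z - w)).
Proof.
have -> : coh_class z = coh_class w <-> z - w \in @is_coboundary X n.
  rewrite Quotient.idealrBE; split=> [h|/eqP //]; exact/eqP.
by rewrite inE.
Qed.

Lemma coh_class_is_zmod_morphism (X : topologicalType) (n : nat) :
  zmod_morphism (@coh_class X n).
Proof. by move=> z w; rewrite /coh_class raddfB. Qed.

HB.instance Definition _ (X : topologicalType) (n : nat) :=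
  GRing.isZmodMorphism.Build _ _ (@coh_class X n)
    (@coh_class_is_zmod_morphism X n).

(* k |-> i + k, so that sigma composed with vertex_segment 0 p is the front
   p-face of sigma, and with vertex_segment p q (n = p + q) the back q-face;
   inord only has a junk value when i + p > n. *)
Definition vertex_segment (n i p : nat) (k : 'I_p.+1) : 'I_n.+1 :=
  inord (i + k).

(* The cup product of a and b, evaluated on simplices of dimension
   n = p + q; keeping n as a parameter avoids transports along equalities
   between degrees. *)
Definition cup_cochain (X : topologicalType) (p q n : nat)
    (a : cochain X p) (b : cochain X q) : cochain X n :=
  fun sigma => a (subsimplex sigma (@vertex_segment n 0 p)) *
               b (subsimplex sigma (@vertex_segment n p q)).

Lemma coboundaryE (X : topologicalType) (n : nat) (c : cochain X n) sigma :
  coboundary c sigma = \sum_(0 <= i < n.+2) (-1) ^+ i *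
    c (subsimplex sigma (fun k : 'I_n.+1 => inord (bump i k))).
Proof.
rewrite big_mkord; apply: eq_bigr => i _; congr (_ * c (subsimplex _ _)).
by apply/funext => k; apply/val_inj; rewrite /= inordK // (ltn_ord (lift i k)).
Qed.

Lemma coboundary_cup (X : topologicalType) (p q n : nat) (a : cochain X p)
    (b : cochain X q) (sigma : singular_simplex X n.+1) :
  (p + q)%N = n ->
  coboundary (cup_cochain a b : cochain X n) sigma =
  cup_cochain (coboundary a) b sigma
  + (-1) ^+ p * cup_cochain a (coboundary b) sigma.
Proof.
move=> pqn; rewrite coboundaryE /cup_cochain !coboundaryE.
have vE (d m : nat) (u v : 'I_d.+1 -> nat) : u =1 v ->
    (fun k => inord (u k) : 'I_m.+1) = (fun k => inord (v k)).
  by move=> uv; apply/funext => k; rewrite uv.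
have sE (d e m : nat) (u : 'I_d.+1 -> nat) (v : nat -> nat)
    (tau : singular_simplex X m) : (forall k, u k <= e)%N ->
    subsimplex (subsimplex tau (fun k : 'I_e.+1 => inord (v k)))
      (fun k : 'I_d.+1 => inord (u k)) =
    subsimplex tau (fun k : 'I_d.+1 => inord (v (u k))).
  move=> ue; rewrite subsimplex_comp; congr (subsimplex _ _).
  by apply/funext => k /=; rewrite inordK // ltnS.
have bumple (d i : nat) (k : 'I_d.+1) : (bump i k <= d.+1)%N.
  by rewrite /bump; have := ltn_ord k; case: (i <= k)%N => /=; lia.
rewrite /vertex_segment.
under eq_bigr => i _.
  rewrite (sE _ _ _ _ (bump i) sigma); last first.
    by move=> k; rewrite add0n; have := ltn_ord k; lia.
  rewrite (sE _ _ _ _ (bump i) sigma); last first.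
    by move=> k; have := ltn_ord k; lia.
  over.
under [X in X * _]eq_bigr => i _.
  rewrite (sE _ _ _ _ (addn 0) sigma); last exact: bumple.
  over.
under [X in _ + _ * (_ * X)]eq_bigr => i _.
  rewrite (sE _ _ _ _ (addn p) sigma); last exact: bumple.
  over.
rewrite (big_cat_nat (n := p.+1)) //=; last first.
  by rewrite -pqn !ltnS (leq_trans (leq_addr q p)).
rewrite [X in _ = X * _ + _]big_nat_recr //= [X in _ = _ + _ * (_ * X)]big_ltn //.
rewrite mulrDl mulrDr mulrDr -addrA; congr (_ + _).
  rewrite mulr_suml; apply: eq_big_nat => i /andP[_ ip]; rewrite mulrA.
  congr (_ * a (subsimplex _ _) * b (subsimplex _ _)); apply: vE => k.
  by rewrite /bump; lia.
rewrite addrA [X in _ = X + _](_ : _ = 0) ?add0r; last first.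
  rewrite expr0 mul1r exprS mulN1r !mulNr mulrA addrC; apply/eqP.
  rewrite subr_eq0; apply/eqP.
    congr (_ * _ * _); [congr (a (subsimplex _ _))|congr (b (subsimplex _ _))].
    by apply: vE => k; rewrite /bump; have := ltn_ord k; lia.
  by apply: vE => k; rewrite /bump; lia.
have shiftE (F : nat -> R) :
    \sum_(p.+1 <= i < n.+2) F i = \sum_(1 <= i < q.+2) F (i + p)%N.
  by rewrite -[p.+1]add1n big_addn; congr (\sum_(_ <= i < _) _); lia.
rewrite shiftE !mulr_sumr; apply: eq_big_nat => i /andP[i0 _].
rewrite exprD [_ ^+ i * _]mulrC -!mulrA; congr (_ * _).
rewrite [RHS]mulrCA; congr (_ * (_ * _)).
  congr (a (subsimplex _ _)); apply: vE => k.
  by rewrite /bump; have := ltn_ord k; lia.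
by congr (b (subsimplex _ _)); apply: vE => k; rewrite /bump; lia.
Qed.


Lemma cup_cocycle_subproof (X : topologicalType) (p q n : nat)
    (pqn : (p + q)%N = n) (z : cocycle X p) (w : cocycle X q) :
  (cup_cochain z w : cochain X n) \in @is_cocycle X n.
Proof.
rewrite inE; apply/funext => s; rewrite coboundary_cup //.
have /= := cocycleP z; have /= := cocycleP w; rewrite !inE => w0 z0.
by rewrite /cup_cochain z0 w0 mul0r mulr0 mulr0 addr0.
Qed.

Definition cup_cocycle (X : topologicalType) (p q n : nat)
    (pqn : (p + q)%N = n) (z : cocycle X p) (w : cocycle X q) : cocycle X n :=
  Cocycle (cup_cocycle_subproof pqn z w).

Definition cup (X : topologicalType) (p q n : nat) (pqn : (p + q)%N = n)
    (x : cohomology X p) (y : cohomology X q) : cohomology X n :=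
  coh_class (cup_cocycle pqn (coh_repr x) (coh_repr y)).

Lemma cup_cochainDl (X : topologicalType) (p q n : nat)
    (a a' : cochain X p) (b : cochain X q) :
  cup_cochain (a + a') b = cup_cochain a b + cup_cochain a' b :> cochain X n.
Proof. by apply/funext => s; exact: mulrDl. Qed.

Lemma cup_cochainDr (X : topologicalType) (p q n : nat)
    (a : cochain X p) (b b' : cochain X q) :
  cup_cochain a (b + b') = cup_cochain a b + cup_cochain a b' :> cochain X n.
Proof. by apply/funext => s; exact: mulrDr. Qed.

Lemma coboundaries_cupl (X : topologicalType) (p q n : nat)
    (pqn : (p + q)%N = n) (a : cochain X p) (w : cocycle X q) :
  coboundaries a -> coboundaries (cup_cochain a w : cochain X n).
Proof.
case: p pqn a => [|p] pqn a /=.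
  move=> ->; rewrite (_ : cup_cochain _ _ = 0); last first.
    by apply/funext => s; exact: mul0r.
  by case: n {pqn} => [//|n] /=; exists 0 => //; rewrite raddf0.
case: n pqn => [//|n] pqn [u _ <-] /=.
exists (cup_cochain u w) => //; apply/funext => s.
have {}pqn : (p + q)%N = n by case: pqn.
rewrite coboundary_cup //; have /= := cocycleP w; rewrite inE => w0.
by rewrite [X in _ * X]/cup_cochain w0 mulr0 mulr0 addr0.
Qed.

Lemma coboundaries_cupr (X : topologicalType) (p q n : nat)
    (pqn : (p + q)%N = n) (z : cocycle X p) (b : cochain X q) :
  coboundaries b -> coboundaries (cup_cochain z b : cochain X n).
Proof.
case: q pqn b => [|q] pqn b /=.
  move=> ->; rewrite (_ : cup_cochain _ _ = 0); last first.
    by apply/funext => s; exact: mulr0.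
  by case: n {pqn} => [//|n] /=; exists 0 => //; rewrite raddf0.
case: n pqn => [|n] pqn; first by rewrite addnS in pqn.
move=> [u _ <-] /=.
exists (fun s => (-1) ^+ p * cup_cochain z u s) => //; apply/funext => s.
have {}pqn : (p + q)%N = n by move: pqn; rewrite addnS => -[].
transitivity ((-1) ^+ p * coboundary (cup_cochain z u : cochain X n) s).
  by rewrite /coboundary mulr_sumr; apply: eq_bigr => i _; rewrite mulrCA.
rewrite coboundary_cup //; have /= := cocycleP z; rewrite inE => z0.
rewrite [X in X + _]/cup_cochain z0 mul0r add0r mulrA -exprD addnn -mul2n.
by rewrite exprM sqrrN expr1n expr1n mul1r.
Qed.

Lemma cup_class (X : topologicalType) (p q n : nat) (pqn : (p + q)%N = n)
    (z : cocycle X p) (w : cocycle X q) :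
  cup pqn (coh_class z) (coh_class w) = coh_class (cup_cocycle pqn z w).
Proof.
rewrite /cup; set z' := coh_repr _; set w' := coh_repr _.
have /coh_classP zz' : coh_class z' = coh_class z by rewrite coh_reprK.
have /coh_classP ww' : coh_class w' = coh_class w by rewrite coh_reprK.
apply: (@eq_trans _ _ (coh_class (cup_cocycle pqn z w'))).
  apply/coh_classP => /=.
  have := coboundaries_cupl pqn w' zz'; congr coboundaries.
  apply/funext => s; exact: mulrBl.
apply/coh_classP => /=.
have := coboundaries_cupr pqn z ww'; congr coboundaries.
apply/funext => s; exact: mulrBr.
Qed.

Lemma cupBl (X : topologicalType) (p q n : nat) (pqn : (p + q)%N = n)
    (y : cohomology X q) :
  zmod_morphism (fun x : cohomology X p => cup pqn x y).
Proof.
move=> x x'; rewrite -(coh_reprK x) -(coh_reprK x') -(coh_reprK y) -raddfB.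
rewrite !cup_class -raddfB; congr coh_class; apply/val_inj/funext => s.
exact: mulrBl.
Qed.

Lemma cupBr (X : topologicalType) (p q n : nat) (pqn : (p + q)%N = n)
    (x : cohomology X p) :
  zmod_morphism (fun y : cohomology X q => cup pqn x y).
Proof.
move=> y y'; rewrite -(coh_reprK x) -(coh_reprK y) -(coh_reprK y') -raddfB.
rewrite !cup_class -raddfB; congr coh_class; apply/val_inj/funext => s.
exact: mulrBr.
Qed.

HB.instance Definition _ (X : topologicalType) (p q n : nat)
    (pqn : (p + q)%N = n) (x : cohomology X p) :=
  GRing.isZmodMorphism.Build _ _ (@cup X p q n pqn x) (@cupBr X p q n pqn x).

Section Pullback.
Variables (X Y : topologicalType) (f : continuousType X Y) (n : nat).

Definition push_simplex (sigma : singular_simplex X n) :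
  singular_simplex Y n := f \o sigma.

Definition pullback_cochain (c : cochain Y n) : cochain X n :=
  fun sigma => c (push_simplex sigma).

End Pullback.

Lemma coboundary_pullback (X Y : topologicalType) (f : continuousType X Y)
    (n : nat) (c : cochain Y n) :
  coboundary (pullback_cochain f c) = pullback_cochain f (coboundary c).
Proof.
apply/funext => s; apply: eq_bigr => i _; congr (_ * c _).
by apply/continuousEP.
Qed.

Lemma pullback_cocycle_subproof (X Y : topologicalType)
    (f : continuousType X Y) (n : nat) (z : cocycle Y n) :
  pullback_cochain f z \in @is_cocycle X n.
Proof.
rewrite inE coboundary_pullback; have /= := cocycleP z; rewrite inE => ->.
exact/funext.
Qed.

Definition pullback_cocycle (X Y : topologicalType) (f : continuousType X Y)
    (n : nat) (z : cocycle Y n) : cocycle X n :=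
  Cocycle (pullback_cocycle_subproof f z).

Definition pullback (X Y : topologicalType) (f : continuousType X Y)
    (n : nat) (x : cohomology Y n) : cohomology X n :=
  coh_class (pullback_cocycle f (coh_repr x)).

Lemma pullback_class (X Y : topologicalType) (f : continuousType X Y)
    (n : nat) (z : cocycle Y n) :
  pullback f (coh_class z) = coh_class (pullback_cocycle f z).
Proof.
rewrite /pullback; set z' := coh_repr _.
have /coh_classP zz' : coh_class z' = coh_class z by rewrite coh_reprK.
apply/coh_classP; rewrite (_ : val _ = pullback_cochain f (val (z' - z))) //.
case: n z @z' zz' => [|n] z z' /=; first by move=> ->.
by move=> [u _ <-]; exists (pullback_cochain f u); rewrite ?coboundary_pullback.
Qed.

Lemma pullback_is_zmod_morphism (X Y : topologicalType)
    (f : continuousType X Y) (n : nat) : zmod_morphism (@pullback X Y f n).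
Proof.
move=> x y; rewrite -(coh_reprK x) -(coh_reprK y) -raddfB !pullback_class.
by rewrite -raddfB; congr coh_class; apply/val_inj/funext.
Qed.

HB.instance Definition _ (X Y : topologicalType) (f : continuousType X Y)
    (n : nat) :=
  GRing.isZmodMorphism.Build _ _ (@pullback X Y f n)
    (@pullback_is_zmod_morphism X Y f n).

Lemma pullback_cup (X Y : topologicalType) (f : continuousType X Y)
    (p q n : nat) (pqn : (p + q)%N = n)
    (x : cohomology Y p) (y : cohomology Y q) :
  pullback f (cup pqn x y) = cup pqn (pullback f x) (pullback f y).
Proof.
rewrite -(coh_reprK x) -(coh_reprK y) cup_class !pullback_class cup_class.
congr coh_class; apply/val_inj/funext => s.
by congr (cocycle_val (coh_repr x) _ * cocycle_val (coh_repr y) _);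
  apply/continuousEP.
Qed.

(* H^*(X; R), the direct sum of the H^n(X; R): finitely supported families. *)
Record total_cohomology (X : topologicalType) := TotalCohomology {
  component :> forall n, cohomology X n;
  component_finsupp : exists N, forall n, (N <= n)%N -> component n = 0 }.

HB.instance Definition _ (X : topologicalType) :=
  gen_eqMixin (total_cohomology X).
HB.instance Definition _ (X : topologicalType) :=
  gen_choiceMixin (total_cohomology X).

Lemma total_eqP (X : topologicalType) (x y : total_cohomology X) :
  (forall n, x n = y n) <-> x = y.
Proof.
split=> [|-> //]; case: x y => [x xP] [y yP] /= xy.
have {}xy : x = y by apply/functional_extensionality_dep.
by move: xP yP; rewrite xy => xP yP; congr TotalCohomology; exact: Prop_irrelevance.
Qed.

Section TotalCohomology.
Variable X : topologicalType.
Implicit Types x y : total_cohomology X.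

Lemma total_zero_subproof :
  exists N, forall n, (N <= n)%N -> (0 : cohomology X n) = 0.
Proof. by exists 0%N. Qed.

Definition total_zero := TotalCohomology total_zero_subproof.

Lemma total_opp_subproof x :
  exists N, forall n, (N <= n)%N -> - x n = 0.
Proof. by have [N xN] := component_finsupp x; exists N => n /xN->; rewrite oppr0. Qed.

Definition total_opp x := TotalCohomology (total_opp_subproof x).

Lemma total_add_subproof x y :
  exists N, forall n, (N <= n)%N -> x n + y n = 0.
Proof.
have [N xN] := component_finsupp x; have [M yM] := component_finsupp y.
by exists (maxn N M) => n; rewrite geq_max => /andP[/xN-> /yM->]; rewrite addr0.
Qed.

Definition total_add x y := TotalCohomology (total_add_subproof x y).

Lemma total_addA : associative total_add.
Proof. by move=> x y z; apply/total_eqP => n; exact: addrA. Qed.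

Lemma total_addC : commutative total_add.
Proof. by move=> x y; apply/total_eqP => n; exact: addrC. Qed.

Lemma total_add0r : left_id total_zero total_add.
Proof. by move=> x; apply/total_eqP => n; exact: add0r. Qed.

Lemma total_addNr : left_inverse total_zero total_opp total_add.
Proof. by move=> x; apply/total_eqP => n; exact: addNr. Qed.

HB.instance Definition _ := GRing.isZmodule.Build (total_cohomology X)
  total_addA total_addC total_add0r total_addNr.

Lemma one_cocycle_subproof : (cst 1 : cochain X 0) \in @is_cocycle X 0.
Proof.
rewrite inE; apply/funext => s; rewrite /coboundary !big_ord_recl big_ord0.
by rewrite addr0 expr0 expr1 mulN1r mul1r subrr.
Qed.

Definition one_cocycle : cocycle X 0 := Cocycle one_cocycle_subproof.

Lemma total_one_subproof : exists N, forall n, (N <= n)%N ->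
  (if n is 0 return cohomology X n then coh_class one_cocycle else 0) = 0.
Proof. by exists 1%N => -[|n]. Qed.

Definition total_one := TotalCohomology total_one_subproof.

(* (x y)_n is the sum of the x_p y_q over p + q = n *)
Definition total_mul_fun x y (n : nat) : cohomology X n :=
  \sum_(p < n.+1) cup (subnKC (ltnSE (ltn_ord p))) (x p) (y (n - p)%N).

Lemma total_mul_subproof x y :
  exists N, forall n, (N <= n)%N -> total_mul_fun x y n = 0.
Proof.
have [N xN] := component_finsupp x; have [M yM] := component_finsupp y.
exists (N + M)%N => n NMn; rewrite /total_mul_fun big1 // => p _.
have [Np|pN] := leqP N p.
  rewrite xN // -(subrr (0 : cohomology X p)).
  by rewrite (cupBl _ (y (n - p)%N)) subrr.
by rewrite yM ?raddf0 //; lia.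
Qed.

Definition total_mul x y := TotalCohomology (total_mul_subproof x y).

Definition total_cup_cochain (a b : forall n, cochain X n) (n : nat) :
    cochain X n :=
  fun s => \sum_(p < n.+1) a p (subsimplex s (@vertex_segment n 0 p)) *
    b (n - p)%N (subsimplex s (@vertex_segment n p (n - p))).

Arguments total_cup_cochain a b n _ : clear implicits.

Definition total_cup_cocycle (z w : forall n, cocycle X n) (n : nat) :
    cocycle X n :=
  \sum_(p < n.+1) cup_cocycle (subnKC (ltnSE (ltn_ord p))) (z p) (w (n - p)%N).

Lemma total_cup_cocycleE (z w : forall n, cocycle X n) (n : nat) :
  val (total_cup_cocycle z w n) = total_cup_cochain z w n.
Proof.
rewrite /total_cup_cocycle raddf_sum; apply/funext => s.
exact: (big_morph (fun c : cochain X n => c s) (id1 := 0) (op1 := +%R)).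
Qed.

Lemma total_mul_class x y (z w : forall n, cocycle X n) (n : nat) :
  (forall n, x n = coh_class (z n)) -> (forall n, y n = coh_class (w n)) ->
  total_mul x y n = coh_class (total_cup_cocycle z w n).
Proof.
move=> xz yw; rewrite /= /total_mul_fun raddf_sum.
by apply: eq_bigr => p _; rewrite xz yw cup_class.
Qed.

Lemma subsimplex_segment (n i d j e : nat) (s : singular_simplex X n) :
  (j + e <= d)%N ->
  subsimplex (subsimplex s (@vertex_segment n i d)) (@vertex_segment d j e) =
  subsimplex s (@vertex_segment n (i + j) e).
Proof.
move=> jed; rewrite subsimplex_comp; congr (subsimplex _ _).
apply/funext => k; rewrite /vertex_segment /= inordK ?addnA //.
by have := ltn_ord k; lia.
Qed.

Lemma subsimplex_id (n : nat) (s : singular_simplex X n) :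
  subsimplex s (@vertex_segment n 0 n) = s.
Proof.
apply/continuousEP => t /=; congr (s _); apply/val_inj/rowP => j.
rewrite mxE (big_pred1 j) // => k.
by rewrite /vertex_segment add0n inord_val.
Qed.

Lemma total_cup_cochainA (a b c : forall n, cochain X n) (n : nat) :
  total_cup_cochain (total_cup_cochain a b) c n =
  total_cup_cochain a (total_cup_cochain b c) n.
Proof.
apply/funext => s; rewrite /total_cup_cochain.
pose T k j l := a k (subsimplex s (@vertex_segment n 0 k)) *
  (b j (subsimplex s (@vertex_segment n k j)) *
   c l (subsimplex s (@vertex_segment n (k + j) l))).
transitivity (\sum_(0 <= p < n.+1) \sum_(0 <= k < p.+1) T k (p - k)%N (n - p)%N).
  rewrite big_mkord; apply: eq_bigr => p _; rewrite mulr_suml big_mkord.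
  apply: eq_bigr => k _; have kp := ltn_ord k; have pn := ltn_ord p.
  rewrite /T !subsimplex_segment ?mulrA ?add0n ?subnKC //; lia.
transitivity (\sum_(0 <= k < n.+1) \sum_(0 <= j < (n - k).+1)
    T k j (n - k - j)%N); last first.
  rewrite big_mkord; apply: eq_bigr => k _; rewrite mulr_sumr big_mkord.
  apply: eq_bigr => j _; have kn := ltn_ord k; have jk := ltn_ord j.
  by rewrite /T !subsimplex_segment ?addn0 //; lia.
transitivity (\sum_(0 <= p < n.+1) \sum_(0 <= k < n.+1 | (k <= p)%N)
    T k (p - k)%N (n - p)%N).
  apply: eq_big_nat => p /andP[_ pn].
  by rewrite (@big_nat_widen _ _ _ _ _ n.+1).
rewrite (exchange_big_dep_nat xpredT) //=.
apply: eq_big_nat => k /andP[_ kn].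
transitivity (\sum_(0 + k <= p < n.+1) T k (p - k)%N (n - p)%N).
  by rewrite [RHS](@big_nat_widenl _ _ _ _ 0).
rewrite big_addn -subSn //; apply: eq_big_nat => j /andP[_ jnk].
by rewrite addnK subnDA subnAC.
Qed.

Lemma total_mulA : associative total_mul.
Proof.
move=> x y z; apply/total_eqP => n; pose r x n := coh_repr (component x n).
have rE x' m : x' m = coh_class (r x' m) by rewrite /r coh_reprK.
have mE x' y' m : total_mul x' y' m =
    coh_class (total_cup_cocycle (r x') (r y') m) by exact: total_mul_class.
rewrite (total_mul_class _ (rE x) (mE y z)) (total_mul_class _ (mE x y) (rE z)).
congr coh_class; apply/val_inj; rewrite !total_cup_cocycleE.
transitivity (total_cup_cochain (r x)
    (total_cup_cochain (r y) (r z)) n).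
  congr (total_cup_cochain _ _ n); apply/functional_extensionality_dep => m.
  exact: total_cup_cocycleE.
rewrite -total_cup_cochainA.
congr (total_cup_cochain _ _ n); apply/functional_extensionality_dep => m.
by rewrite [RHS]total_cup_cocycleE.
Qed.

Definition one_cocycles (n : nat) : cocycle X n :=
  if n is 0 return cocycle X n then one_cocycle else 0.

Lemma total_oneE n : total_one n = coh_class (one_cocycles n).
Proof. by case: n => //= n; rewrite raddf0. Qed.

Lemma total_mul1r : left_id total_one total_mul.
Proof.
move=> x; apply/total_eqP => n.
rewrite (total_mul_class _ total_oneE (fun n => esym (coh_reprK (x n)))).
rewrite -[RHS]coh_reprK; congr coh_class; apply/val_inj/funext => s.
rewrite total_cup_cocycleE /total_cup_cochain big_ord_recl big1 ?addr0.
  rewrite mul1r /=; have xE m : m = n ->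
      val (coh_repr (x m)) (subsimplex s (@vertex_segment n 0 m)) =
      val (coh_repr (x n)) s by move=> ->; rewrite subsimplex_id.
  exact: xE (subn0 n).
by move=> p _; exact: mul0r.
Qed.

Lemma total_mulr1 : right_id total_one total_mul.
Proof.
move=> x; apply/total_eqP => n.
rewrite (total_mul_class _ (fun n => esym (coh_reprK (x n))) total_oneE).
rewrite -[RHS]coh_reprK; congr coh_class; apply/val_inj/funext => s.
rewrite total_cup_cocycleE /total_cup_cochain big_ord_recr big1 ?add0r /=.
  have oneE m t : m = 0%N -> val (one_cocycles m) t = 1.
    by move=> m0; move: t; rewrite m0.
  rewrite add0r subsimplex_id -[RHS]mulr1; congr (_ * _).
  exact: oneE (subnn n).
move=> p _; have : (0 < n - p)%N by rewrite subn_gt0.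
by case: (n - p)%N => // m _; exact: mulr0.
Qed.

Lemma total_mulDl : left_distributive total_mul +%R.
Proof.
move=> x y z; apply/total_eqP => n.
transitivity (total_mul_fun x z n + total_mul_fun y z n) => //.
rewrite -big_split; apply: eq_bigr => p _ /=.
rewrite -(coh_reprK (x p)) -(coh_reprK (y p)) -(coh_reprK (z _)) -raddfD.
rewrite !cup_class -raddfD; congr coh_class; apply/val_inj/funext => s.
exact: mulrDl.
Qed.

Lemma total_mulDr : right_distributive total_mul +%R.
Proof.
move=> x y z; apply/total_eqP => n.
transitivity (total_mul_fun x y n + total_mul_fun x z n) => //.
by rewrite -big_split; apply: eq_bigr => p _; rewrite /= raddfD.
Qed.

HB.instance Definition _ := GRing.Zmodule_isPzRing.Build (total_cohomology X)
  total_mulA total_mul1r total_mulr1 total_mulDl total_mulDr.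

End TotalCohomology.

Section TotalPullback.
Variables (X Y : topologicalType) (f : continuousType X Y).

Lemma total_pullback_subproof (x : total_cohomology Y) :
  exists N, forall n, (N <= n)%N -> pullback f (x n) = 0.
Proof.
by have [N xN] := component_finsupp x; exists N => n /xN ->; rewrite raddf0.
Qed.

Definition total_pullback (x : total_cohomology Y) : total_cohomology X :=
  TotalCohomology (total_pullback_subproof x).

Lemma total_pullback_is_zmod_morphism : zmod_morphism total_pullback.
Proof. by move=> x y; apply/total_eqP => n; exact: raddfB. Qed.

HB.instance Definition _ := GRing.isZmodMorphism.Build _ _ total_pullback
  total_pullback_is_zmod_morphism.

Lemma total_pullback_is_monoid_morphism : monoid_morphism total_pullback.
Proof.
split=> [|x y]; apply/total_eqP => n.
  case: n => [|n]; last exact: raddf0.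
  by rewrite /= pullback_class; congr coh_class; apply/val_inj.
rewrite /= /total_mul_fun raddf_sum.
by apply: eq_bigr => p _; exact: pullback_cup.
Qed.

HB.instance Definition _ := GRing.isMonoidMorphism.Build _ _ total_pullback
  total_pullback_is_monoid_morphism.

End TotalPullback.

End Cochains.

Arguments total_cohomology K R X : clear implicits.
Arguments cohomology K R X n : clear implicits.
Arguments pullback K R {X Y} f {n} x.
Arguments total_pullback K R {X Y} f x.

(* The least n satisfying P, and +oo when there is none. *)
Definition least (P : nat -> Prop) : \bar int :=
  match pselect (exists n, `[< P n >]) with
  | left exP => (Posz (ex_minn exP))%:E
  | right _ => +oo%E
  end.

Definition inclusion (X : topologicalType) (U : set X) : U -> X := set_val.

Lemma inclusion_continuous (X : topologicalType) (U : set X) :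
  continuous (@inclusion X U).
Proof. exact: initial_continuous. Qed.

HB.instance Definition _ (X : topologicalType) (U : set X) :=
  isContinuous.Build _ _ (@inclusion X U) (@inclusion_continuous X U).

Definition restriction (X Y : topologicalType) (f : continuousType X Y)
  (U : set X) : continuousType U Y := f \o @inclusion X U.

Definition path_connected (K : realType) (X : topologicalType) :=
  forall x y : X, exists gamma : K -> X,
    [/\ {within `[0, 1], continuous gamma}, gamma 0 = x & gamma 1 = y].

Section CohomologicalDistance.
Variables (K : realType) (R : comPzRingType) (X Y : topologicalType).
Variables f g : continuousType X Y.

Definition has_cohomological_cover (n : nat) :=
  exists U : 'I_n.+1 -> set X,
    [/\ forall j, open (U j),
        \bigcup_j U j = setT
      & forall (j : 'I_n.+1) (m : nat) (y : cohomology K R Y m),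
          pullback K R (restriction f (U j)) y =
          pullback K R (restriction g (U j)) y].

Definition cohomological_distance : \bar int := least has_cohomological_cover.

Definition difference_image : set (total_cohomology K R X) :=
  range (fun y : total_cohomology K R Y =>
    total_pullback K R f y - total_pullback K R g y).

End CohomologicalDistance.

Arguments has_cohomological_cover K R {X Y} f g n.
Arguments cohomological_distance K R {X Y} f g.
Arguments difference_image K R {X Y} f g _.

Definition lcp (A : pzRingType) (J : set A) : \bar int :=
  least (fun n => forall x : 'I_n.+1 -> A, (forall i, J (x i)) ->
    \prod_(i < n.+1) x i = 0).

(* Main.v *)
(* If x_i restricts to 0 on U_i, subtracting the coboundary of a cochain
   extended by zero represents x_i by a cocycle vanishing on the simplices
     inside
   U_i; the product of these cocycles vanishes on every simplex lying in some
     U_i. A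
   cocycle c with this property, for an open cover, is a coboundary: iterated
   barycentric subdivision S is homotopic to the identity through
   D_m = sum_(i < m) T S^i, and on a given simplex all terms c (S^m s) and
   c (T S^m s) vanish for large m by the Lebesgue number lemma, so that
   h s = lim_m c (D_m s) is well defined and its coboundary is c. *)
From HB Require Import structures.
Require Import Defs.
From mathcomp Require Import all_boot all_order all_algebra.
From mathcomp Require Import all_classical all_reals.
From mathcomp Require Import topology normedtype sequences.
From mathcomp Require Import zify.

Set Implicit Arguments.
Unset Strict Implicit.
Unset Printing Implicit Defensive.

Import Order.TTheory GRing.Theory Num.Theory.
Import numFieldNormedType.Exports.

Local Open Scope classical_set_scope.
Local Open Scope ring_scope.

(** * Subdivision of affine cochains *)

Section AffineCochains.
Variable R : pzRingType.

Definition del (V : Type) (i : nat) (v : seq V) := take i v ++ drop i.+1 v.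

Lemma del0 (V : Type) x (v : seq V) : del 0 (x :: v) = v.
Proof. by rewrite /del /= drop0. Qed.

Lemma size_del (V : Type) i (v : seq V) :
  (i < size v)%N -> size (del i v) = (size v).-1.
Proof. by move=> iv; rewrite size_cat size_take size_drop iv; lia. Qed.

Lemma map_del (V W : Type) (L : V -> W) i v : map L (del i v) = del i (map L v).
Proof. by rewrite /del map_cat map_take map_drop. Qed.

Lemma mem_del (V : eqType) i (v : seq V) x : x \in del i v -> x \in v.
Proof. by rewrite mem_cat => /orP[/mem_take|/mem_drop]. Qed.

(** The simplicial coboundary on lists of vertices, augmented: a one-point list has [[::]] as its
    face. *)
Definition face_sum (V : Type) (phi : seq V -> R) (v : seq V) : R :=
  \sum_(i < size v) (-1) ^+ i * phi (del i v).

Lemma eq_face_sum (V : Type) (phi psi : seq V -> R) v :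
  (forall i, (i < size v)%N -> phi (del i v) = psi (del i v)) ->
  face_sum phi v = face_sum psi v.
Proof. by move=> e; apply: eq_bigr => i _; rewrite e. Qed.

Lemma face_sum0 (V : Type) (phi : seq V -> R) v :
  (forall i, (i < size v)%N -> phi (del i v) = 0) -> face_sum phi v = 0.
Proof. by move=> e; rewrite /face_sum big1 // => i _; rewrite e // mulr0. Qed.

Lemma face_sum_nil (V : Type) (phi : seq V -> R) : face_sum phi [::] = 0.
Proof. exact: big_ord0. Qed.

Lemma face_sumB (V : Type) (phi psi : seq V -> R) v :
  face_sum (fun w => phi w - psi w) v = face_sum phi v - face_sum psi v.
Proof. by rewrite -sumrB; apply: eq_bigr => i _; rewrite mulrBr. Qed.

Lemma face_sum_cons (V : Type) (phi : seq V -> R) x v :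
  face_sum phi (x :: v) = phi v - face_sum (phi \o cons x) v.
Proof.
rewrite /face_sum /= big_ord_recl mul1r del0 -sumrN.
by congr (_ + _); apply: eq_bigr => i _; rewrite exprS mulN1r mulNr.
Qed.

(** By [face_sum_cons], the two copies of [face_sum phi v] cancel and the rest is the same identity
    for [phi \o cons x] on the shorter list. *)
Lemma face_sumK (V : Type) (phi : seq V -> R) v :
  face_sum (face_sum phi) v = 0.
Proof.
elim: v phi => [|x v IH] phi; first exact: face_sum_nil.
rewrite face_sum_cons (@eq_face_sum _ (face_sum phi \o cons x)
  (fun w => phi w - face_sum (phi \o cons x) w)); last first.
  by move=> i _; exact: face_sum_cons.
by rewrite face_sumB IH subr0 subrr.
Qed.

(** * Subdivision and its homotopy to the identity *)

Section Subdivision.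
Variables (V : Type) (b : seq V -> V).
Implicit Types (phi psi : seq V -> R) (v : seq V).

(* A cochain [phi] is evaluated on the affine simplex with vertices [v], and
   [phi \o cons x] is [phi] evaluated on cones with apex [x]. So [sd] is dual to
   the recursion [S v = b v * S (boundary v)], and [sd_htpy] to
   [T v = b v * (v - T (boundary v))], in the complex augmented by [[::]]. *)
Fixpoint sd_rec n phi v : R :=
  if n is m.+1 then face_sum (sd_rec m (phi \o cons (b v))) v else phi v.

Definition sd phi v := sd_rec (size v) phi v.

Fixpoint sd_htpy_rec n phi v : R :=
  if n is m.+1 then
    phi (b v :: v) - face_sum (sd_htpy_rec m (phi \o cons (b v))) v
  else 0.

Definition sd_htpy phi v := sd_htpy_rec (size v) phi v.

Lemma sd_cons phi x v : let u := x :: v in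
  sd phi u = face_sum (sd (phi \o cons (b u))) u.
Proof. by apply: eq_face_sum => i ui; rewrite /sd size_del. Qed.

Lemma sd_htpy_cons phi x v : let u := x :: v in
  sd_htpy phi u =
    phi (b u :: u) - face_sum (sd_htpy (phi \o cons (b u))) u.
Proof.
by congr (_ - _); apply: eq_face_sum => i ui; rewrite /sd_htpy size_del.
Qed.

(** Induction over faces matches the recursion of [sd] and [sd_htpy], which passes from a list to
    all its faces and not only to its tail. *)
Lemma face_ind (P : seq V -> Prop) : P [::] ->
  (forall x v, (forall i, (i <= size v)%N -> P (del i (x :: v))) ->
    P (x :: v)) -> forall v, P v.
Proof.
move=> P0 PS v; have [n] := ubnP (size v).
elim: n v => // n IH [//|x v] vn; apply: PS => i iv.
by apply: IH; rewrite size_del //; move: vn => /=; lia.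
Qed.

Lemma sdB phi psi v : sd (fun w => phi w - psi w) v = sd phi v - sd psi v.
Proof.
elim/face_ind: v phi psi => [//|x v IH] phi psi.
by rewrite !sd_cons -face_sumB; apply: eq_face_sum => i iv; exact: IH.
Qed.

Lemma sd_htpyB phi psi v :
  sd_htpy (fun w => phi w - psi w) v = sd_htpy phi v - sd_htpy psi v.
Proof.
elim/face_ind: v phi psi => [|x v IH] phi psi; first by rewrite subr0.
rewrite !sd_htpy_cons opprB [X in _ = _ + X]addrC addrACA
  [X in _ = _ + X]addrC -[X in _ = _ + X]opprB; congr (_ - _).
by rewrite -face_sumB; apply: eq_face_sum => i iv; exact: IH.
Qed.

(** Coning turns [face_sum phi] into [phi - face_sum phib]. By induction on faces, [sd] of the
    second term is again a face sum, which the outer [face_sum] kills. *)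
Lemma sd_face_sum phi v : sd (face_sum phi) v = face_sum (sd phi) v.
Proof.
elim/face_ind: v phi => [|x v IH] phi; first by rewrite !face_sum_nil /sd /=
  face_sum_nil.
set u := x :: v; rewrite sd_cons -/u.
set phib := phi \o cons (b u).
rewrite (@eq_face_sum _ _ (fun w => sd phi w - face_sum (sd phib) w)).
  by rewrite face_sumB face_sumK subr0.
move=> i iu; rewrite -IH // -sdB; congr sd; apply/funext => w.
exact: face_sum_cons.
Qed.

Lemma sd_htpyP phi v :
  phi v - sd phi v = sd_htpy (face_sum phi) v + face_sum (sd_htpy phi) v.
Proof.
elim/face_ind: v phi => [|x v IH] phi.
  by rewrite face_sum_nil addr0 subrr.
set u := x :: v; rewrite sd_htpy_cons -/u sd_cons -/u [face_sum phi
  _]face_sum_cons.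
set phib := phi \o cons (b u).
(* The coned coboundary is [phi - face_sum phib]; the induction hypothesis for [phib] on each face
   rewrites [sd_htpy (face_sum phib)]. *)
have -> : face_sum (sd_htpy (face_sum phi \o cons (b u))) u =
    face_sum (fun w => sd_htpy phi w -
      (phib w - sd phib w - face_sum (sd_htpy phib) w)) u.
  apply: eq_face_sum => i iu; rewrite IH // addrK -sd_htpyB; congr sd_htpy.
  by apply/funext => w; exact: face_sum_cons.
rewrite !face_sumB face_sumK subr0 opprB [RHS]addrC addrA.
rewrite -[RHS]addrA -[_ - _ - _]addrA subrKA addrCA.
by congr (_ + _); rewrite addrCA subrr addr0.
Qed.

Definition iter_htpy m phi v := \sum_(i < m) iter i sd (sd_htpy phi) v.

Lemma iter_sd_face_sum m phi : iter m sd (face_sum phi) = face_sum (iter m sd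
  phi).
Proof.
by elim: m => //= m ->; apply/funext => v; exact: sd_face_sum.
Qed.

Lemma iter_sdB m phi psi v :
  iter m sd (fun w => phi w - psi w) v = iter m sd phi v - iter m sd psi v.
Proof.
elim: m v => //= m IH v; rewrite -sdB; congr sd; exact/funext.
Qed.

(** On a cocycle the homotopy formula reads [phi - sd phi = face_sum (sd_htpy phi)]. Applying the
    iterates of [sd], which commute with [face_sum], makes the sum telescope. *)
Lemma iter_htpyP m phi v : (forall w, face_sum phi w = 0) ->
  phi v - iter m sd phi v = face_sum (iter_htpy m phi) v.
Proof.
move=> phi0; have e : face_sum (sd_htpy phi) = fun w => phi w - sd phi w.
  apply/funext => w; rewrite sd_htpyP [X in X + _](_ : _ = 0) ?add0r //.
  (* Zero is written as a difference so that [sd_htpyB] shows that [sd_htpy] sends it to zero. *)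
  have -> : face_sum phi = fun w => phi w - phi w.
    by apply/funext => w'; rewrite phi0 subrr.
  by rewrite sd_htpyB subrr.
transitivity (\sum_(i < m) iter i sd (face_sum (sd_htpy phi)) v).
  under eq_bigr do rewrite e iter_sdB -iterSr.
  elim: m => [|m IH]; first by rewrite big_ord0 subrr.
  by rewrite big_ord_recr /= -IH subrKA.
under eq_bigr do rewrite iter_sd_face_sum.
rewrite exchange_big /=; apply: eq_bigr => i _; rewrite mulr_sumr //.
Qed.

End Subdivision.

(** * Naturality in the vertices *)

Section Naturality.
Variables (V W : Type) (bV : seq V -> V) (bW : seq W -> W) (L : V -> W).
(** Restricted to nonempty lists: the barycenter of [[::]] will be a default vertex, which a vertex
    map need not preserve. *)
Hypothesis bL : forall x v, L (bV (x :: v)) = bW (map L (x :: v)).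
Implicit Types (phi : seq W -> R) (v : seq V).

Lemma face_sum_map phi v : face_sum phi (map L v) = face_sum (phi \o map L) v.
Proof. by rewrite /face_sum size_map; under eq_bigr do rewrite -map_del. Qed.

Lemma sd_map phi v : sd bV (phi \o map L) v = sd bW phi (map L v).
Proof.
elim/face_ind: v phi => [//|x v IH] phi.
rewrite sd_cons map_cons sd_cons -map_cons face_sum_map.
apply: eq_face_sum => i iv; rewrite /= -IH // -bL.
by congr sd; apply/funext => w.
Qed.

Lemma sd_htpy_map phi v :
  sd_htpy bV (phi \o map L) v = sd_htpy bW phi (map L v).
Proof.
elim/face_ind: v phi => [//|x v IH] phi.
rewrite sd_htpy_cons map_cons sd_htpy_cons -map_cons face_sum_map /= bL.
congr (_ - _); apply: eq_face_sum => i iv; rewrite /= -IH //.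
by congr sd_htpy; apply/funext => w /=; rewrite bL.
Qed.

Lemma iter_htpy_map m phi v :
  iter_htpy bV m (phi \o map L) v = iter_htpy bW m phi (map L v).
Proof.
apply: eq_bigr => i _; elim: {i}(i : nat) v => [|i IH] v /=.
  exact: sd_htpy_map.
by rewrite -sd_map; congr sd; apply/funext.
Qed.

End Naturality.
End AffineCochains.

(** * Affine simplices and their mesh *)

Lemma sumr_const_seq (V : nmodType) (I : Type) (r : seq I) (x : V) :
  \sum_(i <- r) x = x *+ size r.
Proof. by rewrite big_const_seq count_predT iter_addr_0. Qed.

Section AffineSimplices.
Variable K : realType.

Lemma std_simplex_comb (k : nat) (I : Type) (r : seq I) (a : I -> K)
    (x : I -> std_simplex K k) :
  (forall i, 0 <= a i) -> \sum_(i <- r) a i = 1 ->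
  \sum_(i <- r) a i *: val (x i) \in std_simplex K k.
Proof.
move=> a0 a1; have x_spx i : std_simplex K k (val (x i)) by exact/set_mem/valP.
apply/mem_set; split=> [j|].
  rewrite summxE sumr_ge0 // => i _; rewrite mxE mulr_ge0 //.
  exact: (x_spx i).1.
under eq_bigr do rewrite summxE; rewrite exchange_big /= -[RHS]a1.
apply: eq_bigr => i _; under eq_bigr do rewrite mxE.
by rewrite -mulr_sumr (x_spx i).2 mulr1.
Qed.

Lemma delta_std_simplex (k : nat) (i : 'I_k.+1) :
  (delta_mx 0 i : 'rV[K]_k.+1) \in std_simplex K k.
Proof.
apply/mem_set; split=> [j|]; first by rewrite mxE ler0n.
rewrite (bigD1 i) //= big1 ?addr0; first by rewrite mxE !eqxx.
by move=> j /negPf ji; rewrite mxE ji andbF.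
Qed.

Definition vertex (k : nat) (i : 'I_k.+1) : std_simplex K k :=
  SigSub (delta_std_simplex i).

Definition vertices (k : nat) : seq (std_simplex K k) :=
  mkseq (fun j => vertex (inord j)) k.+1.

Lemma std_simplex_bounds (k : nat) (t : std_simplex K k) j :
  0 <= val t 0 j <= 1.
Proof.
have [t0 t1] := set_mem (valP t); rewrite [_ <= _]t0 /= -t1 (bigD1 j) //=.
by rewrite lerDl sumr_ge0.
Qed.

Section Affine.
Variables (k n : nat) (w : seq (std_simplex K k)).

Lemma affine_subproof (t : std_simplex K n) :
  \sum_i val t 0 i *: val (nth (vertex ord0) w i) \in std_simplex K k.
Proof.
by have [t0 t1] := set_mem (valP t); exact: std_simplex_comb.
Qed.

(* Missing points of [w] default to a vertex and extra ones are ignored, so this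
   is meaningful only when [size w = n.+1]. *)
Definition affine (t : std_simplex K n) : std_simplex K k :=
  SigSub (affine_subproof t).

Lemma affine_continuous : continuous affine.
Proof.
apply: continuous_comp_initial => t.
apply: (@continuous_comp _ _ _ set_val
  (fun t : 'rV[K]_n.+1 => \sum_i t 0 i *: val (nth (vertex ord0) w i))).
  exact: initial_continuous.
apply: continuous_big => [|i _]; first exact: add_continuous.
move=> u; apply: (@continuousZ _ _ _ (fun t : 'rV[K]_n.+1 => t 0 i) (cst _) u).
  exact: coord_continuous.
exact: cst_continuous.
Qed.

HB.instance Definition _ := isContinuous.Build _ _ affine affine_continuous.

End Affine.

Lemma affine_vertices n : affine (n := n) (vertices n) = id.
Proof.
apply/funext => t; apply/val_inj; rewrite [RHS]row_sum_delta /=.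
by apply: eq_bigr => i _; rewrite nth_mkseq // inord_val.
Qed.

Lemma affine_face k n (w : seq (std_simplex K k)) (i : 'I_n.+2) :
  size w = n.+2 -> affine w \o vertex_map (lift i) = affine (n := n) (del i w).
Proof.
move=> sw; apply/funext => t; apply/val_inj => /=.
(* [vertex_map (lift i)] puts weight 0 on vertex [i], so only the points of [w] indexed by [lift i]
   remain. *)
transitivity (\sum_l val t 0 l *: val (nth (vertex ord0) w (lift i l))).
  rewrite [RHS](partition_big (lift i) xpredT) //=; apply: eq_bigr => j _.
  by rewrite mxE scaler_suml; apply: eq_bigr => l /eqP <-.
apply: eq_bigr => l _.
congr (_ *: val _); rewrite /del nth_cat size_take sw (ltn_ord i) /= /bump.
case: ltnP => li; first by rewrite nth_take.
by rewrite nth_drop; congr nth; lia.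
Qed.

Lemma vertex_map_fun_sum (p k : nat) (phi : 'I_p.+1 -> 'I_k.+1) (I : Type)
    (r : seq I) (a : I -> K) (y : I -> 'rV[K]_p.+1) :
  vertex_map_fun phi (\sum_(i <- r) a i *: y i) =
  \sum_(i <- r) a i *: vertex_map_fun phi (y i).
Proof.
apply/rowP => j; rewrite summxE mxE.
under eq_bigr do rewrite summxE; rewrite exchange_big /=.
by apply: eq_bigr => i _; rewrite !mxE mulr_sumr; under eq_bigr do rewrite mxE.
Qed.

Lemma vertex_map_affine p k n (phi : 'I_p.+1 -> 'I_k.+1)
    (w : seq (std_simplex K p)) :
  size w = n.+1 ->
  vertex_map phi \o affine (n := n) w = affine (map (vertex_map phi) w).
Proof.
move=> sw; apply/funext => t; apply/val_inj => /=.
rewrite vertex_map_fun_sum; apply: eq_bigr => i _.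
by rewrite (nth_map (vertex ord0)) // sw.
Qed.

Lemma vertex_map_vertex (p k : nat) (phi : 'I_p.+1 -> 'I_k.+1) i :
  vertex_map phi (vertex i) = vertex (phi i).
Proof.
apply/val_inj/rowP => j; rewrite !mxE /= big_mkcond (bigD1 i) //= big1 ?addr0.
  by rewrite !mxE !eqxx /= eq_sym; case: eqP.
by move=> l /negPf li; rewrite mxE li andbF if_same.
Qed.

Lemma vertex_map_vertices n (i : 'I_n.+2) :
  map (vertex_map (lift i)) (vertices n) = del i (vertices n.+1).
Proof.
have sdel : size (del i (vertices n.+1)) = n.+1.
  by rewrite size_del ?size_mkseq.
apply: (@eq_from_nth _ (vertex ord0)); first by rewrite sdel size_map
  size_mkseq.
move=> j; rewrite size_map size_mkseq => jn.
rewrite (nth_map (vertex ord0)) ?size_mkseq // nth_mkseq //.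
rewrite /del nth_cat size_take size_mkseq (ltn_ord i).
transitivity (vertex (inord (bump i j)) : std_simplex K n.+1); last first.
  rewrite /bump; case: ltnP => li.
    by rewrite nth_take // nth_mkseq //; lia.
  rewrite nth_drop nth_mkseq; last by lia.
  by congr (vertex (inord _)); lia.
rewrite vertex_map_vertex; congr vertex; apply/val_inj.
by rewrite /= !inordK //; have := ltn_ord i; rewrite /bump; lia.
Qed.

(** The default of [insubd] is reached only for the empty list, as [val_barycenter] shows. *)
Definition barycenter k (w : seq (std_simplex K k)) : std_simplex K k :=
  insubd (vertex ord0) ((size w)%:R^-1 *: \sum_(x <- w) val x).

Lemma val_barycenter k x (w : seq (std_simplex K k)) : x \in w ->
  val (barycenter w) = (size w)%:R^-1 *: \sum_(x <- w) val x.
Proof.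
case: w => // y w _; rewrite val_insubd scaler_sumr std_simplex_comb //.
  by move=> _; rewrite invr_ge0.
by rewrite sumr_const_seq -[LHS]mulr_natr mulVf // pnatr_eq0.
Qed.

Lemma barycenterB k (a : 'rV[K]_k.+1) x (w : seq (std_simplex K k)) :
  x \in w ->
  val (barycenter w) - a = (size w)%:R^-1 *: \sum_(y <- w) (val y - a).
Proof.
move=> xw; rewrite (val_barycenter xw) sumrB sumr_const_seq scalerBr.
by rewrite -[a *+ _]scaler_nat scalerA mulVf ?scale1r // pnatr_eq0;
  case: (w) xw.
Qed.

Lemma vertex_map_barycenter p k (phi : 'I_p.+1 -> 'I_k.+1) x
    (w : seq (std_simplex K p)) :
  vertex_map phi (barycenter (x :: w)) =
  barycenter (map (vertex_map phi) (x :: w)).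
Proof.
apply/val_inj; rewrite [RHS](@val_barycenter _ (vertex_map phi x)) ?mem_head //.
transitivity (vertex_map_fun phi (val (barycenter (x :: w)))) => //.
rewrite (val_barycenter (mem_head x w)) !scaler_sumr vertex_map_fun_sum.
by rewrite big_map size_map.
Qed.

End AffineSimplices.

(** * Mesh estimates for barycenters *)

Section Mesh.
Variables (K : realType) (k : nat).
Implicit Types (v w : seq (std_simplex K k)) (d : K).

Definition mesh_le d w :=
  forall x y, x \in w -> y \in w -> `|val x - val y| <= d.

(* Containment in every closed ball containing [v] replaces containment in the
   convex hull of [v]. *)
Definition enclosed w v := forall (a : 'rV[K]_k.+1) r,
  (forall x, x \in v -> `|val x - a| <= r) ->
  forall y, y \in w -> `|val y - a| <= r.

Lemma enclosed_trans u w v : enclosed u w -> enclosed w v -> enclosed u v.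
Proof. by move=> uw wv a r /wv; exact: uw. Qed.

Lemma enclosed_del i v : enclosed (del i v) v.
Proof. by move=> a r va y /mem_del; exact: va. Qed.

Lemma mesh_le_del i d v : mesh_le d v -> mesh_le d (del i v).
Proof. by move=> vd x y /mem_del xv /mem_del; exact: vd. Qed.

Lemma enclosed_barycenter x w v : x \in v -> enclosed w v ->
  enclosed (barycenter v :: w) v.
Proof.
move=> xv wv a r va y; rewrite inE => /predU1P[->|]; last exact: wv.
have sv : 0 < (size v)%:R :> K by rewrite ltr0n; case: (v) xv.
rewrite (barycenterB _ xv) normrZ gtr0_norm ?invr_gt0 // ler_pdivrMl //.
rewrite mulr_natl -sumr_const_seq.
apply: le_trans (ler_norm_sum _ _ _) _; rewrite big_seq [leRHS]big_seq.
by apply: ler_sum => z zv; exact: va.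
Qed.

(** Enclosure is used twice: balls of radius [d] about points of [v] contain [w], hence balls of
    radius [d] about points of [w] contain [v] and so [w]. *)
Lemma mesh_le_enclosed d w v : enclosed w v -> mesh_le d v -> mesh_le d w.
Proof.
move=> wv vd x y xw yw; apply: (wv (val y)) xw => z zv; rewrite distrC.
by apply: (wv (val z)) yw => u uv; exact: vd.
Qed.

(** In the average of the [s] differences [y - x] the one with [y = x] is zero, which leaves
    [(s - 1) / s * d]; this grows with [s <= N.+1]. *)
Lemma barycenter_dist N d v x : (size v <= N.+1)%N -> mesh_le d v -> x \in v ->
  `|val (barycenter v) - val x| <= N%:R / N.+1%:R * d.
Proof.
move=> vN vd xv.
have d0 : 0 <= d by apply: le_trans (vd _ _ xv xv).
have sv : 0 < (size v)%:R :> K by rewrite ltr0n; case: (v) xv.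
rewrite (barycenterB _ xv) normrZ gtr0_norm ?invr_gt0 // (big_rem x) //= subrr
  add0r.
apply: (@le_trans _ _ ((size v)%:R^-1 * ((size v).-1%:R * d))).
  rewrite ler_wpM2l ?invr_ge0 //; apply: le_trans (ler_norm_sum _ _ _) _.
  rewrite -(size_rem xv) mulr_natl -sumr_const_seq.
  rewrite big_seq [leRHS]big_seq.
  by apply: ler_sum => z /mem_rem zv; exact: vd.
rewrite mulrA ler_wpM2r // mulrC ler_pdivrMr // mulrAC ler_pdivlMr //.
rewrite -!natrM ler_nat; case: (size v) vN => //= s; nia.
Qed.

End Mesh.

Lemma rV_norm_le (K : realType) n (x : 'rV[K]_n) c :
  0 <= c -> (forall j, `|x ord0 j| <= c) -> `|x| <= c.
Proof.
move=> c0 xc; rewrite [leLHS]/Num.norm /= mx_normrE; apply/bigmax_leP.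
by split=> // -[i j] _; rewrite ord1.
Qed.

(** * Shrinking of simplices under subdivision *)

Section SmallSubdivision.
Variables (K : realType) (R : pzRingType) (k : nat).
Notation bary := (@barycenter K k).
Implicit Types (phi : seq (std_simplex K k) -> R).
Implicit Types (v w : seq (std_simplex K k)) (d : K).

(** Each simplex of the subdivision is a cone from the barycenter over a simplex subdividing a face.
    Edges at the apex are short by [barycenter_dist], the others by induction; [N] stays fixed so
    that one ratio serves all faces. *)
Lemma sd_eq0 N d phi v : (size v <= N.+1)%N -> mesh_le d v ->
  (forall w, size w = size v -> enclosed w v ->
    mesh_le (N%:R / N.+1%:R * d) w -> phi w = 0) ->
  sd bary phi v = 0.
Proof.
elim/face_ind: v phi => [|x v IH] phi vN vd phi0.
  by apply: phi0 => // a r _ y; rewrite in_nil.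
rewrite sd_cons; set u := x :: v in vN vd phi0 *.
apply: face_sum0 => i iu; have su := size_del iu.
apply: IH => // [||w]; [by rewrite su; lia|exact: mesh_le_del|].
rewrite su => sw wu wd; have {}wu := enclosed_trans wu (@enclosed_del _ _ i u).
have xu : x \in u by exact: mem_head.
have d0 : 0 <= N%:R / N.+1%:R * d.
  by rewrite mulr_ge0 ?divr_ge0 // (le_trans _ (vd _ _ xu xu)).
(* The ball about the barycenter contains all of [u], hence the list [w] enclosed by [u]. *)
have bw y : y \in w -> `|val y - val (bary u)| <= N%:R / N.+1%:R * d.
  apply: (wu (val (bary u))) => z zu; rewrite distrC; exact: barycenter_dist.
apply: phi0 => /=; first by rewrite sw.
  exact: enclosed_barycenter xu wu.
move=> y z; rewrite !inE => /predU1P[->|yw] /predU1P[->|zw].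
- by rewrite subrr normr0.
- by rewrite distrC; exact: bw.
- exact: bw.
- exact: wd.
Qed.

(** The homotopy only uses simplices inside the hull of [v], one dimension up; they need not be
    smaller than [v]. *)
Lemma sd_htpy_eq0 phi v :
  (forall w, size w = (size v).+1 -> enclosed w v -> phi w = 0) ->
  sd_htpy bary phi v = 0.
Proof.
elim/face_ind: v phi => [//|x v IH] phi phi0.
rewrite sd_htpy_cons; set u := x :: v in phi0 *.
have xu : x \in u by exact: mem_head.
rewrite phi0 ?sub0r //; last by apply: (enclosed_barycenter xu) => a r.
rewrite face_sum0 ?oppr0 // => i iu; have su := size_del iu.
apply: IH => // w; rewrite su => sw wu; apply: phi0 => /=; first by rewrite sw.
exact: (enclosed_barycenter xu (enclosed_trans wu (@enclosed_del _ _ i u))).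
Qed.

Lemma iter_sd_eq0 N m d phi v : size v = N.+1 -> mesh_le d v ->
  (forall w, size w = N.+1 -> mesh_le ((N%:R / N.+1%:R) ^+ m * d) w ->
    phi w = 0) ->
  iter m (sd bary) phi v = 0.
Proof.
elim: m d v => [|m IH] d v sv vd phi0.
  by apply: phi0 => //; rewrite mul1r.
apply: (@sd_eq0 N d) => //; first by rewrite sv.
move=> w sw _ wd; apply: (IH _ w _ wd) => [|w' sw' w'd]; first by rewrite sw.
by apply: phi0 => //; rewrite exprSr -mulrA.
Qed.

Lemma mesh_le1 v : mesh_le 1 v.
Proof.
move=> x y _ _; apply: rV_norm_le => // j; rewrite !mxE.
have /andP[x0 x1] := std_simplex_bounds x j.
have /andP[y0 y1] := std_simplex_bounds y j.
rewrite ler_norml lerBrDr lerBlDr (le_trans _ x0) /=; first last.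
  by rewrite addrC subr_le0.
by rewrite (le_trans x1) // lerDl.
Qed.

Lemma near_iter_sd_eq0 e phi v : 0 < e -> v != [::] ->
  (forall w, size w = size v -> mesh_le e w -> phi w = 0) ->
  \forall m \near \oo, iter m (sd bary) phi v = 0.
Proof.
move=> e0; case: v => // x v _ phi0; set N := size v.
have q1 : `|N%:R / N.+1%:R : K| < 1.
  by rewrite ger0_norm ?divr_ge0 // ltr_pdivrMr // mul1r ltr_nat.
(* The initial mesh is at most 1, so after [m] subdivisions it is at most the [m]-th power of this
   ratio. *)
have /cvgr0_norm_lt /(_ _ e0) := cvg_expr q1.
apply: filterS => m qm; apply: (@iter_sd_eq0 N m 1) => //;
  first exact: mesh_le1.
move=> w sw wd; apply: phi0 => // y z yw zw; apply: le_trans (wd _ _ yw zw) _.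
by rewrite mulr1 (le_trans (ler_norm _)) // ltW.
Qed.

End SmallSubdivision.

(** * Compactness of the simplex and Lebesgue numbers *)

Lemma compact_std_simplex (K : realType) k : compact (std_simplex K k).
Proof.
apply: bounded_closed_compact.
  exists 1; split=> // M M1 t tS; apply: rV_norm_le => [|j].
    by rewrite (le_trans _ (ltW M1)).
  have /andP[t0 t1] := std_simplex_bounds (SigSub (mem_set tS)) j.
  by rewrite ger0_norm // (le_trans t1) // ltW.
rewrite (_ : std_simplex K k = \bigcap_(j in setT)
    [set t | 0 <= (t : 'rV[K]_k.+1) ord0 j] `&` [set t | \sum_i t ord0 i = 1]).
  apply: closedI.
    apply: closed_bigI => j _.
    apply: (@preimage_closed _ _ (fun t : 'rV[K]_k.+1 => t ord0 j)
      [set x | 0 <= x]); last exact: closed_ge.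
    by move=> t _; exact: coord_continuous.
  apply: (@preimage_closed _ _ (fun t : 'rV[K]_k.+1 => \sum_i t ord0 i)
    [set x | x = 1]); last exact: closed_eq.
  move=> t _; apply: continuous_big => [|i _]; first exact: add_continuous.
  exact: coord_continuous.
apply/seteqP; split=> t [t0 t1]; split=> //; first by move=> j _; exact: t0.
by move=> j; exact: t0.
Qed.

(** Compactness in its near-covering form: it suffices to find, near each point, a radius that works
    for all nearby centres. *)
Lemma lebesgue_number (K : realType) k (X : topologicalType) (J : Type)
    (U : J -> set X) (sigma : continuousType (std_simplex K k) X) :
  (forall j, open (U j)) -> \bigcup_j U j = setT ->
  exists2 e, 0 < e & forall x : std_simplex K k, exists j,
    forall y : std_simplex K k,
    `|val y - val x| <= e -> U j (sigma y).
Proof.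
move=> Uo UT; suff : \forall e \near (0 : K)^'+, std_simplex K k `<=`
    [set x | exists j, forall y : std_simplex K k,
      `|val y - x| <= e -> U j (sigma y)].
  move=> /(filterI (nbhs_right_gt 0))/filter_ex[e [e0 He]].
  by exists e => // x; apply: He; exact/set_mem/valP.
have /compact_near_coveringP := @compact_std_simplex K k; apply => x xS.
pose x' : std_simplex K k := SigSub (mem_set xS).
have [j _ Ux] : (\bigcup_j U j) (sigma x') by rewrite UT.
(* An open set of the simplex is the trace of an open [W] of the ambient row space, where balls are
   available. *)
have [W Wo WU] : open (sigma @^-1` U j).
  by apply: open_comp (Uo j) => t _; exact: cts_fun.
have Wx : W x by have : (set_val @^-1` W) x' by rewrite WU.
have /nbhs_ballP[r /= r0 rW] : nbhs x W by exact: open_nbhs_nbhs.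
(* Centres [z] within [r / 2] of [x] and radii [e] below [r / 2] keep the ball inside [W]. *)
near=> z e => /=; exists j => y yz; rewrite -[U j _]/((sigma @^-1` U j) y) -WU
  /=.
apply: rW; rewrite -ball_normE /= -(subrKA z).
rewrite (le_lt_trans (ler_normD _ _)) // (splitr r) ltrD //.
  near: z; have r2 : 0 < r / 2 by rewrite divr_gt0.
  have := nbhsx_ballx x _ r2; apply: filterS => t.
  by rewrite -ball_normE.
rewrite distrC (le_lt_trans yz) //.
by near: e; apply: nbhs_right_lt; rewrite divr_gt0.
Unshelve. all: by end_near.
Qed.

(** * Cocycles vanishing on small simplices *)

Section SmallCochains.
Variables (K : realType) (R : comPzRingType) (X : topologicalType).

Definition affine_simplex k n (sigma : singular_simplex K X k)
  (w : seq (std_simplex K k)) : singular_simplex K X n :=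
  sigma \o affine w.

(* The value [0] on sequences of the wrong length makes this an honest cocycle
   for [face_sum] whenever [c] is one. *)
Definition affine_cochain k n (c : cochain K R X n)
    (sigma : singular_simplex K X k) (w : seq (std_simplex K k)) : R :=
  if size w == n.+1 then c (affine_simplex n sigma w) else 0.

Lemma affine_cochain_vertices n (c : cochain K R X n) sigma :
  affine_cochain c sigma (vertices K n) = c sigma.
Proof.
rewrite /affine_cochain size_mkseq eqxx; congr c; apply/continuousEP => t /=.
by rewrite affine_vertices.
Qed.

Lemma affine_cochain_subsimplex p k n (c : cochain K R X n)
    (sigma : singular_simplex K X k) (phi : 'I_p.+1 -> 'I_k.+1) :
  affine_cochain c (subsimplex sigma phi) =
  affine_cochain c sigma \o map (vertex_map phi).
Proof.
apply/funext => w; rewrite /affine_cochain /= size_map.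
case: eqP => // sw; congr c; apply/continuousEP => t /=.
by rewrite -vertex_map_affine.
Qed.

Lemma face_sum_affine_cochain k n (c : cochain K R X n)
    (sigma : singular_simplex K X k) :
  face_sum (affine_cochain c sigma) = affine_cochain (coboundary c) sigma.
Proof.
apply/funext => w; rewrite [RHS]/affine_cochain; case: eqP => sw.
  rewrite /face_sum sw; apply: eq_bigr => i _.
  rewrite /affine_cochain size_del ?sw // eqxx; congr (_ * c _).
  by apply/continuousEP => t /=; rewrite -affine_face.
(* If [w] has the wrong length for [coboundary c], its faces have the wrong length for [c]. *)
apply: face_sum0 => i iw; rewrite /affine_cochain size_del //.
by case: eqP => //; move: sw iw; case: (size w) => // s /eqP; lia.
Qed.

(** Evaluation on the tautological list [vertices] reduces this to [face_sumK]. *)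
Lemma coboundaryK n (c : cochain K R X n) : coboundary (coboundary c) = 0.
Proof.
apply/funext => sigma; rewrite -affine_cochain_vertices.
by rewrite -!face_sum_affine_cochain face_sumK.
Qed.

Lemma affine_dist k n (w : seq (std_simplex K k)) (t : std_simplex K n) a r :
  size w = n.+1 -> (forall x, x \in w -> `|val x - a| <= r) ->
  `|val (affine w t) - a| <= r.
Proof.
move=> sw wr; have [t0 t1] := set_mem (valP t).
rewrite -[a]scale1r -t1 scaler_suml -sumrB -[r]mul1r -t1 mulr_suml.
apply: le_trans (ler_norm_sum _ _ _) _; apply: ler_sum => i _.
rewrite -scalerBr normrZ ger0_norm ?ler_wpM2l //; apply: wr.
by rewrite mem_nth // sw.
Qed.

Variables (J : Type) (U : J -> set X).
Hypotheses (U_open : forall j, open (U j)) (U_cover : \bigcup_j U j = setT).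

Lemma affine_cochain_small k n (c : cochain K R X n)
    (sigma : singular_simplex K X k) :
  (forall (tau : singular_simplex K X n) j, (forall t, U j (tau t)) ->
    c tau = 0) ->
  exists2 e, 0 < e & forall w, mesh_le e w -> affine_cochain c sigma w = 0.
Proof.
move=> c0; have [e e0 eU] := lebesgue_number sigma U_open U_cover.
exists e => // w we; rewrite /affine_cochain; case: eqP => // sw.
have w0 : head (vertex K ord0) w \in w by case: (w) sw => //= x s;
  rewrite mem_head.
(* The Lebesgue ball is centred at the first vertex; it contains the other vertices and, by
   convexity, the whole affine simplex. *)
have [j jU] := eU (head (vertex K ord0) w).
apply: (c0 _ j) => t; apply: jU; apply: affine_dist => // x xw; exact: we.
Qed.

Lemma eventually_const_sum (F : nat -> R) :
  (\forall m \near \oo, F m = 0) ->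
  exists s, \forall m \near \oo, \sum_(i < m) F i = s.
Proof.
move=> [M _ F0]; exists (\sum_(i < M) F i); exists M => // m /= Mm.
rewrite -(subnKC Mm) big_split_ord /= [X in _ + X]big1 ?addr0 // => i _.
by apply: F0; rewrite /= leq_addr.
Qed.

(** [h] is the eventual value of the homotopy sums. For a given [sigma], one [m] is chosen that
    makes the subdivided term vanish and stabilizes the sums on all faces; [iter_htpyP] then gives
    the equation. *)
Lemma coboundary_of_small_vanishing n (c : cochain K R X n.+1) :
  c \in @is_cocycle K R X n.+1 ->
  (forall (sigma : singular_simplex K X n.+1) j, (forall t, U j (sigma t)) ->
    c sigma = 0) ->
  exists h, coboundary h = c.
Proof.
move=> cc c0; pose htpy m (tau : singular_simplex K X n) :=
  iter_htpy (@barycenter K n) m (affine_cochain c tau) (vertices K n).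
have /choice[h hP] (tau : singular_simplex K X n) :
    exists s, \forall m \near \oo, htpy m tau = s.
  apply: (eventually_const_sum (F := fun i => iter i _ (sd_htpy _ _) _)).
  have [e e0 eS] := affine_cochain_small tau c0.
  apply: (near_iter_sd_eq0 e0) => [|w sw we];
    first by rewrite -size_eq0 size_mkseq.
  (* Lists enclosed by a small list are small, so the homotopy also vanishes on small lists. *)
  by apply: sd_htpy_eq0 => w' _ /mesh_le_enclosed/(_ we); exact: eS.
(* For large [m] the homotopy terms no longer depend on [m], which makes [h]
   independent of the number of subdivisions each simplex needs. *)
exists h; apply/funext => sigma.
have sigma0 : \forall m \near \oo,
    iter m (sd (@barycenter K n.+1)) (affine_cochain c sigma) (vertices K
      n.+1) = 0.
  have [e e0 eS] := affine_cochain_small sigma c0.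
  apply: (near_iter_sd_eq0 e0) => [|w _]; last exact: eS.
  by rewrite -size_eq0 size_mkseq.
have faces : \forall m \near \oo, forall i : 'I_n.+2,
    htpy m (subsimplex sigma (lift i)) = h (subsimplex sigma (lift i)).
  by apply: filter_forall => i; exact: hP.
have [m [sigma_m faces_m]] := filter_ex (filterI sigma0 faces).
rewrite -(affine_cochain_vertices c) -[RHS]subr0 -sigma_m.
rewrite iter_htpyP => [|w]; last first.
  rewrite face_sum_affine_cochain; move: cc; rewrite inE => ->.
  by rewrite /affine_cochain if_same.
rewrite /face_sum size_mkseq; apply: eq_bigr => i _; congr (_ * _).
(* Naturality moves the homotopy on a face of [sigma] to the list [vertices] of [sigma] with one
   vertex deleted. *)
rewrite -faces_m /htpy affine_cochain_subsimplex.
rewrite (iter_htpy_map (@vertex_map_barycenter _ _ _ _)).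
by rewrite vertex_map_vertices.
Qed.

Lemma coboundaries_of_small_vanishing n (z : cocycle K R X n) :
  (forall (sigma : singular_simplex K X n) j, (forall t, U j (sigma t)) ->
    val z sigma = 0) ->
  coboundaries (val z).
Proof.
case: n z => [|n] z z0 /=; last first.
  have [h hz] := coboundary_of_small_vanishing (cocycleP z) z0.
  by exists h.
(* In degree 0 the cocycle itself must be zero: the 0-simplex is a point, so each singular one lies
   in some [U j]. *)
apply/funext => sigma.
have [j _ Uj] : (\bigcup_j U j) (sigma (vertex K ord0)) by rewrite U_cover.
apply: (z0 _ j) => t; rewrite (_ : t = vertex K ord0) //.
apply/val_inj/rowP => i; have [_] := set_mem (valP t).
by rewrite big_ord1 (ord1 i) => t1; rewrite [LHS]t1 mxE eqxx.
Qed.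

End SmallCochains.

(** * Relative representatives and products *)

Section Corestriction.
Variables (T X : topologicalType) (A : set X) (f : continuousType T X).
Hypothesis fA : forall t, A (f t).

Definition corestriction (t : T) : A := SigSub (mem_set (fA t)).

Lemma corestriction_continuous : continuous corestriction.
Proof. by apply: continuous_comp_initial => t; exact: cts_fun. Qed.

HB.instance Definition _ :=
  isContinuous.Build _ _ corestriction corestriction_continuous.

End Corestriction.

Section RelativeClasses.
Variables (K : realType) (R : comPzRingType) (X : topologicalType).

Section ExtensionByZero.
Variables (A : set X) (n : nat) (u : cochain K R A n).

(** The choice of [tau] by [cid] is harmless because the inclusion is injective. *)
Definition extension_by_zero : cochain K R X n := fun sigma =>
  if pselect (exists tau, push_simplex (@inclusion X A) tau = sigma) is left e
  then u (projT1 (cid e)) else 0.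

Lemma extension_by_zeroE tau :
  extension_by_zero (push_simplex (@inclusion X A) tau) = u tau.
Proof.
rewrite /extension_by_zero; case: pselect => [e|[]]; last by exists tau.
case: cid => tau' /= e'; congr u; apply/continuousEP => t; apply/val_inj.
by have := congr1 (fun s : singular_simplex K X n => s t) e'.
Qed.

End ExtensionByZero.

(** Exactness of the sequence of the pair [(X, A)] at the cohomology of [X], on the level of
    cocycles. *)
Lemma class_vanishing_on (A : set X) n (x : cohomology K R X n) :
  pullback K R (@inclusion X A) x = 0 ->
  exists2 z, x = coh_class z &
    forall sigma : singular_simplex K X n, (forall t, A (sigma t)) ->
      val z sigma = 0.
Proof.
rewrite -(coh_reprK x); set z := coh_repr x; rewrite pullback_class.
rewrite -[0](raddf0 (@coh_class K R A n)) => /coh_classP; rewrite subr0 /=.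
have push (sigma : singular_simplex K X n) (sA : forall t, A (sigma t)) :
    sigma = push_simplex (@inclusion X A) (corestriction sA).
  exact/continuousEP.
case: n x z push => [|n] x z push /=.
  move=> z0; exists z => // sigma sA; rewrite (push _ sA).
  exact: (congr1 (fun c : cochain K R A 0 => c _) z0).
move=> [u _ uz].
have cP : coboundary (extension_by_zero u) \in @is_cocycle K R X n.+1.
  by rewrite inE coboundaryK.
exists (z - Cocycle cP); first apply/coh_classP.
  by rewrite opprB addrC subrK; exists (extension_by_zero u).
move=> sigma sA; apply/eqP; rewrite subr_eq0; apply/eqP => /=.
rewrite {1}(push _ sA); transitivity (coboundary u (corestriction sA)).
  by rewrite uz.
(* Faces of a simplex in [A] stay in [A], where the extension agrees with [u]. *)
apply: eq_bigr => i _; congr (_ * _); rewrite -extension_by_zeroE.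
by congr extension_by_zero; apply/continuousEP.
Qed.

(** A lift to cochains relative to all [U j]-small simplices. A family of sets replaces their union,
    since a simplex in the union need not lie in one member. *)
Definition vanishing_on J (U : J -> set X) (x : total_cohomology K R X) :=
  exists2 z : forall n, cocycle K R X n, (forall n, x n = coh_class (z n)) &
    forall n (sigma : singular_simplex K X n) j, (forall t, U j (sigma t)) ->
      val (z n) sigma = 0.

(** The relative cup product: front and back faces of a simplex in [W l] stay in [W l], so one
    factor of every term vanishes. *)
Lemma vanishing_on_mul I J L (U : I -> set X) (V : J -> set X) (W : L -> set X)
    x y :
  (forall l, (exists i, W l = U i) \/ (exists j, W l = V j)) ->
  vanishing_on U x -> vanishing_on V y -> vanishing_on W (x * y).
Proof.
move=> WUV [z xz z0] [w yw w0].
exists (total_cup_cocycle z w) => [n|n sigma l Wl].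
  exact: total_mul_class.
rewrite total_cup_cocycleE /total_cup_cochain big1 // => p _.
have [[i WU]|[j WV]] := WUV l.
  by rewrite (z0 _ _ i) ?mul0r // -WU => t; exact: Wl.
by rewrite (w0 _ _ j) ?mulr0 // -WV => t; exact: Wl.
Qed.

Lemma vanishing_on_prod n (U : 'I_n -> set X) (x : 'I_n -> total_cohomology K
  R X) :
  (forall i, vanishing_on (fun _ : unit => U i) (x i)) ->
  vanishing_on U (\prod_(i < n) x i).
Proof.
elim: n U x => [|n IH] U x xU.
  (* The empty product is the unit; vanishing over the empty family is vacuous. *)
  rewrite big_ord0; exists (one_cocycles K R X) => [n|n sigma []//].
  exact: total_oneE.
rewrite big_ord_recl; apply: vanishing_on_mul (xU ord0) (IH _ _ _).
  move=> l; case: (unliftP ord0 l) => [j ->|->]; last by left; exists tt.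
  by right; exists j.
by move=> i; exact: xU.
Qed.

Lemma vanishing_on_cover J (U : J -> set X) x :
  (forall j, open (U j)) -> \bigcup_j U j = setT -> vanishing_on U x -> x = 0.
Proof.
move=> Uo UT [z xz z0]; apply/total_eqP => n; rewrite xz.
rewrite -[RHS](raddf0 (@coh_class K R X n)); apply/coh_classP; rewrite subr0.
apply: (coboundaries_of_small_vanishing Uo UT) => sigma j.
exact: z0.
Qed.

End RelativeClasses.

(** * The inequality *)

Lemma pullback_restriction (K : realType) (R : comPzRingType)
    (X Y : topologicalType) (f : continuousType X Y) (A : set X) n
    (y : cohomology K R Y n) :
  pullback K R (@inclusion X A) (pullback K R f y) =
  pullback K R (restriction f A) y.
Proof.
rewrite -(coh_reprK y) !pullback_class; congr coh_class;
  apply/val_inj/funext => s.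
by congr (val (coh_repr y) _); apply/continuousEP.
Qed.

(** A weaker condition is met no later; if [Q] never holds, the bound is [+oo]. *)
Lemma le_least (P Q : nat -> Prop) : (forall n, Q n -> P n) ->
  (least P <= least Q)%E.
Proof.
move=> QP; rewrite /least; case: (pselect (exists n, `[< Q n >])) => [exQ|_].
  case: pselect => [exP|[]]; last first.
    by have [n /asboolP/QP Pn] := exQ; exists n; exact/asboolP.
  rewrite lee_fin; case: ex_minnP => m _ mP;
    case: ex_minnP => n /asboolP/QP Pn _.
  by apply: mP; exact/asboolP.
by rewrite leey.
Qed.

Theorem theorem1p4 (K : realType) (R : comPzRingType)
    (X Y : topologicalType) (f g : continuousType X Y) :
  path_connected K X -> path_connected K Y ->
  (lcp (difference_image K R f g) <= cohomological_distance K R f g)%E.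
Proof.
move=> _ _; apply: le_least => n [U [Uo UT fgU]] x xJ.
(* The [n.+1] factors are matched with the [n.+1] sets of the cover: the [i]-th is to vanish on
   [U i]. *)
apply: (vanishing_on_cover Uo UT); apply: vanishing_on_prod => i.
have [y _ <-] := xJ i.
have zP m : exists z : cocycle K R X m,
    (total_pullback K R f y - total_pullback K R g y) m = coh_class z /\
    forall sigma : singular_simplex K X m, (forall t, U i (sigma t)) ->
      val z sigma = 0.
  have [|z ez z0] := @class_vanishing_on K R X (U i) m
    (pullback K R f (y m) - pullback K R g (y m)); last by exists z.
  (* On [U i] the maps [f] and [g] induce the same homomorphism, so the difference restricts to
     zero. *)
  by rewrite raddfB /= !pullback_restriction fgU subrr.
exists (fun m => projT1 (cid (zP m))) => [m|m sigma _]; case: cid => z [] //= _.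
exact.
Qed.
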